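(* Let $X$ be any infinite set. Then $\operatorname{SR}(\mathcal P_X)\le 4$; that is, every countable subset of $\mathcal P_X$ is contained in a subsemigroup of $\mathcal P_X$ generated by at most four elements.
   Context: Partition monoid: let $X'=\{x':x\in X\}$ be a disjoint copy of the set $X$. The elements of $\mathcal P_X$ are all set partitions $\alpha$ of $X\cup X'$ into nonempty blocks. Product: given $\alpha,\beta\in\mathcal P_X$, let $X''=\{x'':x\in X\}$ be a third disjoint copy of $X$; relabel each lower vertex $x'$ of (a graph whose connected components are the blocks of) $\alpha$ as $x''$, relabel each upper vertex $x$ of (a graph representing) $\beta$ as $x''$, and take the union of the two graphs on vertex set $X\cup X''\cup X'$. Then $\alpha\beta\in\mathcal P_X$ is the partition in which $u,v\in X\cup X'$ lie in the same block if and only if they are joined by a (finite) path in this graph. This makes $\mathcal P_X$ a monoid with identity $\{\{x,x'\}:x\in X\}$. The Sierpiński rank $\operatorname{SR}(S)$ of a semigroup $S$ is the least integer $n$ such that every countable subset of $S$ is contained in an $n$-generator subsemigroup of $S$, if such an integer exists, and is infinite otherwise. *)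

(* Defs.v *)
From HB Require Import structures.
From Stdlib Require Import Relation_Operators.
From mathcomp Require Import all_boot.
From mathcomp Require Import boolp classical_sets functions cardinality.

Set Implicit Arguments.
Unset Strict Implicit.
Unset Printing Implicit Defensive.

Local Open Scope classical_set_scope.

Record set_partition (T : Type) := SetPartition {
  blocks :> set (set T);
  blocksP : classical_sets.partition blocks id [set: T] }.

Definition same_block (T : Type) (p : set_partition T) (u v : T) : Prop :=
  exists2 B, blocks p B & B u /\ B v.

Section SetPartitionTheory.
Variable T : Type.
Implicit Types p q : set_partition T.

Lemma same_block_refl p u : same_block p u u.
Proof.
have [+ _ _] := blocksP p; move=> /seteqP[_ /(_ u I)] [B pB Bu].
by exists B.
Qed.

Lemma same_block_sym p u v : same_block p u v -> same_block p v u.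
Proof. by move=> [B pB [Bu Bv]]; exists B. Qed.

Lemma block_unique p B C u : blocks p B -> blocks p C -> B u -> C u -> B = C.
Proof.
have [_ tI _] := blocksP p => pB pC Bu Cu.
by apply: (tI B C pB pC); exists u.
Qed.

Lemma same_block_trans p u v w :
  same_block p u v -> same_block p v w -> same_block p u w.
Proof.
move=> [B pB [Bu Bv]] [C pC [Cv Cw]]; exists B => //; split=> //.
by rewrite (block_unique pB pC Bv Cv).
Qed.

Lemma blocksE p B : blocks p B <-> exists u, B = [set v | same_block p u v].
Proof.
have [_ _ n0] := blocksP p; split=> [pB|[u ->]].
  have [u Bu] := n0 B pB; exists u; apply/seteqP; split=> v /=.
    by move=> Bv; exists B.
  by move=> [C pC [Cu Cv]]; rewrite (block_unique pB pC Bu Cu).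
have [C pC [Cu _]] := same_block_refl p u.
suff -> : [set v | same_block p u v] = C by [].
apply/seteqP; split=> v /=; last by move=> Cv; exists C.
by move=> [D pD [Du Dv]]; rewrite (block_unique pC pD Cu Du).
Qed.

Lemma set_partitionP p q :
  (forall u v, same_block p u v <-> same_block q u v) -> p = q.
Proof.
move=> pq; have : blocks p = blocks q.
  apply/seteqP; split=> B /blocksE[u ->]; apply/blocksE; exists u;
    by apply/seteqP; split=> v /= /pq.
case: p q {pq} => [p pP] [q qP] /= e; subst q; congr SetPartition.
exact: Prop_irrelevance.
Qed.

Variable R : T -> T -> Prop.
Hypothesis Rrefl : forall u, R u u.
Hypothesis Rsym : forall u v, R u v -> R v u.
Hypothesis Rtrans : forall u v w, R u v -> R v w -> R u w.

Lemma classes_partition :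
  classical_sets.partition (range (fun u => [set v | R u v])) id [set: T].
Proof.
split=> [|B C [u _ <-] [v _ <-] [w [/= uw vw]]|B [u _ <-]]; last by exists u.
- by apply/seteqP; split=> // u _; exists [set v | R u v] => //; exists u.
- have uv : R u v by exact: Rtrans uw (Rsym vw).
  apply/seteqP; split=> t /=; first exact: Rtrans (Rsym uv).
  exact: Rtrans uv.
Qed.

Definition classes : set_partition T := SetPartition classes_partition.

Lemma same_block_classes u v : same_block classes u v <-> R u v.
Proof.
split=> [[B [w _ <-]] [/= wu wv]|uv]; first exact: Rtrans (Rsym wu) wv.
exists [set v | R u v]; first by exists u.
by split; [exact: Rrefl|].
Qed.

End SetPartitionTheory.

(** [inl x] is the upper vertex x, and [inr x] is the lower vertex x'. *)
Definition partition_monoid (X : Type) := set_partition (X + X).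

Section PartitionMonoid.
Variable X : Type.
Local Notation P := (partition_monoid X).
Implicit Types a b c : P.

Variant vertex := Upper of X | Middle of X | Lower of X.

Definition in_top (u : X + X) : vertex :=
  match u with inl x => Upper x | inr x => Middle x end.
Definition in_bottom (u : X + X) : vertex :=
  match u with inl x => Middle x | inr x => Lower x end.
Definition outer (u : X + X) : vertex :=
  match u with inl x => Upper x | inr x => Lower x end.

(** Image under the relabelling [f] of the graph in which every block of [a] is
    a complete graph (with loops); its components are the blocks of [a]. *)
Definition relabel (V : Type) (f : X + X -> V) a (v w : V) : Prop :=
  exists u1 u2, [/\ v = f u1, w = f u2 & same_block a u1 u2].

Definition product_graph a b (v w : vertex) : Prop :=
  relabel in_top a v w \/ relabel in_bottom b v w.

(** Edges are symmetric, so a finite path is a [clos_refl_trans] chain. *)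
Definition joined a b (u v : X + X) : Prop :=
  clos_refl_trans _ (product_graph a b) (outer u) (outer v).

Lemma joined_refl a b u : joined a b u u.
Proof. exact: rt_refl. Qed.

Lemma clos_sym V (R : V -> V -> Prop) : (forall v w, R v w -> R w v) ->
  forall v w, clos_refl_trans _ R v w -> clos_refl_trans _ R w v.
Proof.
move=> Rs v w; elim=> [x y /Rs|x|x y z _ xy _ yz]; first exact: rt_step.
  exact: rt_refl.
exact: rt_trans yz xy.
Qed.

Lemma relabel_sym V (f : X + X -> V) a v w :
  relabel f a v w -> relabel f a w v.
Proof. by move=> [x [y [-> -> xy]]]; exists y, x; split=> //; exact: same_block_sym. Qed.

Lemma product_graph_sym a b v w : product_graph a b v w -> product_graph a b w v.
Proof. by case=> h; [left|right]; exact: relabel_sym. Qed.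

Lemma joined_sym a b u v : joined a b u v -> joined a b v u.
Proof. by apply: clos_sym => x y; exact: product_graph_sym. Qed.

Lemma joined_trans a b u v w : joined a b u v -> joined a b v w -> joined a b u w.
Proof. exact: rt_trans. Qed.

Definition pmul a b : P :=
  classes (@joined_refl a b) (@joined_sym a b) (@joined_trans a b).

Lemma same_block_pmul a b u v : same_block (pmul a b) u v <-> joined a b u v.
Proof. exact: same_block_classes. Qed.

Lemma pone_partition :
  classical_sets.partition (range (fun x : X => [set inl x; inr x])) id
    [set: X + X].
Proof.
split=> [|B C [x _ <-] [y _ <-] [w [/= + +]]|B [x _ <-]].
- apply/seteqP; split=> // -[x|x] _; exists [set inl x; inr x];
    by [exists x|left|right].
- by case=> ->; case=> // -[->].
- by exists (inl x); left.
Qed.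

Definition pone : P := SetPartition pone_partition.

Lemma same_block_pone u v :
  same_block pone u v <->
  exists x, (u = inl x \/ u = inr x) /\ (v = inl x \/ v = inr x).
Proof.
split=> [[B [x _ <-]] [/= ux vx]|[x [ux vx]]]; first by exists x.
by exists [set inl x; inr x]; [exists x|].
Qed.

Lemma clos_mono V (R R' : V -> V -> Prop) :
  (forall v w, R v w -> clos_refl_trans _ R' v w) ->
  forall v w, clos_refl_trans _ R v w -> clos_refl_trans _ R' v w.
Proof.
move=> RR v w; elim=> [x y /RR//|x|x y z _ xy _ yz]; first exact: rt_refl.
exact: rt_trans xy yz.
Qed.

Lemma clos_preserve V (R : V -> V -> Prop) (Q : V -> Prop) :
  (forall v w, R v w -> Q v -> Q w) ->
  forall v w, clos_refl_trans _ R v w -> Q v -> Q w.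
Proof. by move=> RQ v w; elim=> [x y /RQ//|//|x y z _ xy _ yz /xy/yz]. Qed.

Lemma clos_contract V (E1 E2 : V -> V -> Prop) (D : set V) :
  (forall v w, E2 v w -> D v /\ D w) ->
  let E v w := E1 v w \/ E2 v w in
  let E' v w := [/\ D v, D w & clos_refl_trans _ E1 v w] \/ E2 v w in
  forall u v, D u -> D v ->
  clos_refl_trans _ E u v <-> clos_refl_trans _ E' u v.
Proof.
move=> E2D E E' u v Du Dv; split=> [uv|]; last first.
  apply: clos_mono => x y [[_ _]|xy]; last by apply: rt_step; right.
  by apply: clos_mono => s t st; apply: rt_step; left.
pose Q w := exists w', [/\ D w', clos_refl_trans _ E' u w'
                         & clos_refl_trans _ E1 w' w].
have [] : Q v; last first.
  move=> w [Dw uw wv]; apply: rt_trans uw _; apply: rt_step; left; by split.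
apply: (clos_preserve _ uv); last by exists u; split=> //; exact: rt_refl.
move=> x y xy [w [Dw uw wx]]; case: xy => xy.
  by exists w; split=> //; apply: rt_trans wx _; apply: rt_step.
have [Dx Dy] := E2D _ _ xy.
exists y; split=> //; last exact: rt_refl.
apply: rt_trans uw _; apply: (@rt_trans _ _ _ x); apply: rt_step; last by right.
by left; split.
Qed.

Lemma clos_embed (V : Type) (g : vertex -> V) a b : injective g ->
  forall v w,
  clos_refl_trans _ (product_graph a b) v w <->
  clos_refl_trans _ (fun s t => relabel (g \o in_top) a s t \/
                                relabel (g \o in_bottom) b s t) (g v) (g w).
Proof.
move=> gI v w; split.
  elim=> [x y xy|x|x y z _ xy _ yz]; last exact: rt_trans xy yz.
    apply: rt_step; case: xy => -[s [t [-> -> st]]].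
      by left; exists s, t.
    by right; exists s, t.
  exact: rt_refl.
set R := fun _ _ => _ => vw.
suff [w' /gI -> //] :
    exists2 w', g w = g w' & clos_refl_trans _ (product_graph a b) v w'.
apply: (@clos_preserve _ R (fun t => exists2 w', t = g w' &
  clos_refl_trans _ (product_graph a b) v w') _ _ _ vw); last first.
  by exists v => //; exact: rt_refl.
move=> x' y' e [z xz vz]; subst x'; case: e => [] [s [t [/gI zs yt st]]]; subst z y'.
  exists (in_top t) => //; apply: rt_trans vz _; apply: rt_step.
  by left; exists s, t.
exists (in_bottom t) => //; apply: rt_trans vz _; apply: rt_step.
by right; exists s, t.
Qed.

(** The four layers of the graph describing a product of three factors are
    [nat * X] restricted to first components 0, 1, 2, 3. *)
Definition layer (i j k : nat) (v : vertex) : nat * X :=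
  match v with Upper x => (i, x) | Middle x => (j, x) | Lower x => (k, x) end.

Definition layer2 (i j : nat) (u : X + X) : nat * X :=
  match u with inl x => (i, x) | inr x => (j, x) end.

Lemma layer_inj i j k : i != j -> i != k -> j != k -> injective (layer i j k).
Proof.
move=> /eqP ij /eqP ik /eqP jk [x|x|x] [y|y|y] //= [].
- by move=> ->.
- by move=> /ij.
- by move=> /ik.
- by move=> /esym/ij.
- by move=> ->.
- by move=> /jk.
- by move=> /esym/ik.
- by move=> /esym/jk.
- by move=> ->.
Qed.

Lemma layer_top i j k : layer i j k \o in_top = layer2 i j.
Proof. by apply/funext => -[]. Qed.
Lemma layer_bottom i j k : layer i j k \o in_bottom = layer2 j k.
Proof. by apply/funext => -[]. Qed.
Lemma layer_outer i j k u : layer i j k (outer u) = layer2 i k u.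
Proof. by case: u. Qed.

Lemma joinedE i j k a b u v : i != j -> i != k -> j != k ->
  joined a b u v <->
  clos_refl_trans _ (fun s t => relabel (layer2 i j) a s t \/
                                relabel (layer2 j k) b s t)
    (layer2 i k u) (layer2 i k v).
Proof.
move=> ij ik jk; rewrite /joined (clos_embed _ _ (layer_inj ij ik jk)).
by rewrite layer_top layer_bottom !layer_outer.
Qed.

Lemma clos_iff V (R R' : V -> V -> Prop) :
  (forall v w, R v w <-> R' v w) ->
  forall v w, clos_refl_trans _ R v w <-> clos_refl_trans _ R' v w.
Proof.
by move=> RR v w; split; apply: clos_mono => x y /RR; exact: rt_step.
Qed.

Lemma layer2_joined i j k a b s t : i != j -> i != k -> j != k ->
  relabel (layer2 i k) (pmul a b) s t <->
  [/\ s.1 = i \/ s.1 = k, t.1 = i \/ t.1 = k &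
    clos_refl_trans _ (fun s t => relabel (layer2 i j) a s t \/
                                relabel (layer2 j k) b s t) s t].
Proof.
move=> ij ik jk; split.
  move=> [u [v [-> -> /same_block_pmul /(joinedE _ _ _ _ ij ik jk) uv]]].
  by split=> //; [case: u {uv}|case: v {uv}] => /= x; auto.
have lay (r : nat * X) : r.1 = i \/ r.1 = k -> exists u, r = layer2 i k u.
  case: r => r x /= [] ->; first by exists (inl x).
  by exists (inr x).
move=> [/lay[u ->] /lay[v ->] uv]; exists u, v; split=> //.
by apply/same_block_pmul/(joinedE _ _ _ _ ij ik jk).
Qed.

Lemma relabel_layer i j a s t : relabel (layer2 i j) a s t ->
  (s.1 = i \/ s.1 = j) /\ (t.1 = i \/ t.1 = j).
Proof.
by move=> [x [y [-> -> _]]]; split; [case: x|case: y] => /= ?; auto.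
Qed.

(** Contracting a two-factor product on the layers [i], [j], [k] inside a graph
    whose other edges [F] avoid the layer [j]. *)
Lemma clos_contract_layers i j k l a b (F : nat * X -> nat * X -> Prop) u v :
  i != j -> i != k -> j != k -> l != i -> l != j -> l != k ->
  let D := [set s : nat * X | [\/ s.1 = i, s.1 = k | s.1 = l]] in
  (forall s t, F s t -> D s /\ D t) -> D u -> D v ->
  clos_refl_trans _ (fun s t =>
    (relabel (layer2 i j) a s t \/ relabel (layer2 j k) b s t) \/ F s t) u v <->
  clos_refl_trans _ (fun s t =>
    relabel (layer2 i k) (pmul a b) s t \/ F s t) u v.
Proof.
move=> ij ik jk /eqP li /eqP lj /eqP lk D FD Du Dv.
rewrite (@clos_contract _ _ _ _ FD _ _ Du Dv).
pose E1 s t := relabel (layer2 i j) a s t \/ relabel (layer2 j k) b s t.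
have El s t : E1 s t -> s.1 <> l /\ t.1 <> l.
  by case=> /relabel_layer [sl tl]; split; intuition congruence.
split; apply: clos_mono => s t.
  move=> [[Ds Dt st]|st]; last by apply: rt_step; right.
  case: (pselect (s.1 = l)) => sl.
    suff -> : t = s by exact: rt_refl.
    apply: (@clos_preserve _ E1 (fun t => t = s) _ _ _ st) => // x y /El [xl _] xs.
    by rewrite xs in xl.
  have tl : t.1 <> l.
    by apply: (@clos_preserve _ E1 (fun t => t.1 <> l) _ _ _ st) => // x y /El [].
  apply: rt_step; left; apply/(layer2_joined _ _ _ _ ij ik jk).
  by split=> //; [case: Ds|case: Dt]; auto.
move=> [/(layer2_joined _ _ _ _ ij ik jk)[si ti st]|st]; apply: rt_step;
  last by right.
left; split=> //.
  by case: si => ?; [exact: Or31|exact: Or32].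
by case: ti => ?; [exact: Or31|exact: Or32].
Qed.

Lemma pmulA : associative pmul.
Proof.
move=> a b c; apply: set_partitionP => u v.
rewrite !same_block_pmul (@joinedE 0 1 3)// (@joinedE 0 2 3)//.
pose A := relabel (layer2 0 1) a.
pose B := relabel (layer2 1 2) b.
pose C := relabel (layer2 2 3) c.
pose G s t := [\/ A s t, B s t | C s t].
apply: (@iff_trans _ (clos_refl_trans _ G (layer2 0 3 u) (layer2 0 3 v))).
  apply: (@iff_trans _ (clos_refl_trans _
    (fun s t => relabel (layer2 1 3) (pmul b c) s t \/ A s t)
    (layer2 0 3 u) (layer2 0 3 v))).
    by apply: clos_iff => s t; tauto.
  rewrite -(@clos_contract_layers 1 2 3 0)//.
  - apply: clos_iff => s t; rewrite /G; split.
      by case=> [[]|] ?; [exact: Or32|exact: Or33|exact: Or31].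
    by case=> ?; [right|left; left|left; right].
  - move=> s t /relabel_layer /= [ss tt]; split.
      by case: ss => ?; [exact: Or33|exact: Or31].
    by case: tt => ?; [exact: Or33|exact: Or31].
  - by case: u => x; [exact: Or33|exact: Or32].
  - by case: v => x; [exact: Or33|exact: Or32].
rewrite -(@clos_contract_layers 0 1 2 3)//.
- apply: clos_iff => s t; rewrite /G; split.
    by case=> ?; [left; left|left; right|right].
  by case=> [[]|] ?; [exact: Or31|exact: Or32|exact: Or33].
- move=> s t /relabel_layer /= [ss tt]; split.
    by case: ss => ?; [exact: Or32|exact: Or33].
  by case: tt => ?; [exact: Or32|exact: Or33].
- by case: u => x; [exact: Or31|exact: Or33].
- by case: v => x; [exact: Or31|exact: Or33].
Qed.

Definition top_of (v : vertex) : X + X :=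
  match v with Upper x | Middle x => inl x | Lower x => inr x end.
Definition bottom_of (v : vertex) : X + X :=
  match v with Upper x => inl x | Middle x | Lower x => inr x end.

Lemma pmul1 : left_id pone pmul.
Proof.
move=> a; apply: set_partitionP => u v; rewrite same_block_pmul; split.
  move=> uv; have ou w : top_of (outer w) = w by case: w.
  rewrite -(ou v).
  apply: (@clos_preserve _ _ (fun w => same_block a u (top_of w)) _ _ _ uv).
    move=> x y [] [s [t [-> ->]]].
      move=> /same_block_pone [z [[]-> []->]] //.
    case: s t => [s|s] [t|t] /= st us; exact: same_block_trans us st.
  by rewrite ou; exact: same_block_refl.
have step w : clos_refl_trans _ (product_graph pone a) (outer w) (in_bottom w).
  case: w => x; last exact: rt_refl.
  apply: rt_step; left; exists (inl x), (inr x); split=> //.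
  by apply/same_block_pone; exists x; auto.
move=> uv; apply: rt_trans (step u) _.
apply: (@rt_trans _ _ _ (in_bottom v)).
  by apply: rt_step; right; exists u, v.
apply: clos_sym (step v) => x y; exact: product_graph_sym.
Qed.

Lemma pmulr1 : right_id pone pmul.
Proof.
move=> a; apply: set_partitionP => u v; rewrite same_block_pmul; split.
  move=> uv; have ou w : bottom_of (outer w) = w by case: w.
  rewrite -(ou v).
  apply: (@clos_preserve _ _ (fun w => same_block a u (bottom_of w)) _ _ _ uv).
    move=> x y [] [s [t [-> ->]]].
      case: s t => [s|s] [t|t] /= st us; exact: same_block_trans us st.
    move=> /same_block_pone [z [[]-> []->]] //.
  by rewrite ou; exact: same_block_refl.
have step w : clos_refl_trans _ (product_graph a pone) (outer w) (in_top w).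
  case: w => x; first exact: rt_refl.
  apply: rt_step; right; exists (inr x), (inl x); split=> //.
  by apply/same_block_pone; exists x; auto.
move=> uv; apply: rt_trans (step u) _.
apply: (@rt_trans _ _ _ (in_top v)).
  by apply: rt_step; left; exists u, v.
apply: clos_sym (step v) => x y; exact: product_graph_sym.
Qed.

HB.instance Definition _ := gen_eqMixin (partition_monoid X).
HB.instance Definition _ := gen_choiceMixin (partition_monoid X).
HB.instance Definition _ :=
  isMonoid.Build (partition_monoid X) pmulA pmul1 pmulr1.

End PartitionMonoid.

Section SierpinskiRank.
Variable S : semigroupType.

Definition subsemigroup (M : set S) : Prop :=
  forall x y, M x -> M y -> M (x * y)%g.

Definition generated_by (G : set S) : set S := smallest subsemigroup G.

Definition countable_sets_generated (n : nat) : Prop :=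
  forall A : set S, countable A ->
    exists2 G : set S, (G #<= `I_n)%card & A `<=` generated_by G.

(** [None] stands for an infinite rank. *)
Definition sierpinski_rank : option nat :=
  match pselect (exists n, `[< countable_sets_generated n >]) with
  | left ex => Some (ex_minn ex)
  | right _ => None
  end.

End SierpinskiRank.

Definition rank_le (r : option nat) (n : nat) : bool :=
  if r is Some m then m <= n else false.

(* Main.v *)
(** Identify [X] with [X * nat] and put sigma (x, i) = (x, i + 1) and
    beta x = (x, 0).  An injection f is encoded by the partition with blocks
    {x, (f x)'} (other lower vertices being singletons); multiplying by it on the
    left, or by its mirror image on the right, relabels upper or lower vertices
    along f.  Given a sequence a_0, a_1, ..., the generators are sigma, its mirror
    sigma*, the mirror beta* of beta, and one partition delta doing two jobs: it
    joins the upper vertex sigma z to the lower vertex (beta z)', and it carries a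
    copy of each a_n between the upper vertices ((y, n), 0) and the lower vertices
    (y, n + 1)'.  Up to components that never meet the rest, sigma delta acts as
    beta, hence
      a_n = sigma delta sigma^n sigma delta delta sigma*^(n + 1) beta*. *)
Require Import Defs.
From Stdlib Require Import Relation_Operators.
From mathcomp Require Import all_boot.
From mathcomp Require Import boolp classical_sets functions cardinality.
Local Open Scope classical_set_scope.

(** * Infinite sets absorb a factor [nat] *)

Lemma injective_card_le {T U : Type} {f : T -> U} :
  injective f -> ([set: T] #<= [set: U])%card.
Proof.
move=> fI; have [F] : $|{injfun [set: T] >-> [set: U]}|.
  by apply/injfunPex; exists f => // x y _ _ /fI.
exact: inj_card_le F.
Qed.

(** By maximality, a family [F] of injective sequences with disjoint ranges can be chosen to miss
    only a finite set [C]. Coding points into [F * nat] leaves room for one more factor [nat];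
    Cantor-Bernstein concludes. *)
Lemma infinite_bij_prod_nat (X : Type) : infinite_set [set: X] ->
  exists f : X * nat -> X, bijective f.
Proof.
elim/Ppointed: X => X Xinf.
  by case: Xinf; rewrite emptyE; exact: finite_set0.
have [F [Finj Fdis Fmax]] := ex_maximal_disjoint_subcollection
  (fun f : nat -> X => range f) [set f | injective f].
pose C := ~` \bigcup_(f in F) range f.
have Cfin : finite_set C.
  apply: contrapT => /infiniteP/ppcard_leP[g].
  have gC i : C (g i) by have := @funS _ _ _ _ g; apply.
  have gI : injective g by move=> i j; apply: inj; rewrite inE.
  have gF : ~ F g.
    by move=> Fg; apply: (gC 0); exists (g : nat -> X) => //; exists 0.
  (* The range of [g] lies in [C], so it is disjoint from every range in [F], and adding [g]
     contradicts maximality. *)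
  apply: (Fmax (F `|` [set (g : nat -> X)])).
  - split; first by move=> f Ff; left.
    by move=> /(_ g) /= h; apply: gF; apply: h; right.
  - by move=> f [/Finj//|->].
  move=> f h [Ff|->] [Fh|->] [x [[i _ fx] [j _ hx]]] //.
  - by apply: Fdis => //; exists x; split; [exists i|exists j].
  - by case: (gC j); exists f => //; exists i => //; rewrite fx hx.
  - by case: (gC i); exists h => //; exists j => //; rewrite fx hx.
have [f0 Ff0] : F !=set0.
  apply/set0P/eqP => F0; apply: Xinf.
  by move: Cfin; rewrite /C F0 bigcup_set0 setC0.
have /countable_injP[k kI] := finite_set_countable Cfin.
(* [c] injects [X] into [F * nat]: odd codes for the points covered by [F], even
   codes for the countable remainder [C]. *)
have /choice[c cP] (x : X) : exists p : (nat -> X) * nat, F p.1 /\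
    ((C x /\ p.2 = (k x).*2) \/ exists2 i, x = p.1 i & p.2 = i.*2.+1).
  have [Cx|/contrapT[f Ff [i _ fi]]] := pselect (C x).
    by exists (f0, (k x).*2); split=> //; left.
  by exists (f, i.*2.+1); split=> //; right; exists i.
have cI : injective c.
  move=> x y cxy; have [_] := cP x; have [_] := cP y; rewrite -cxy.
  case=> [[Cy ->]|[j yj ->]] [[Cx]|[i xi]] /=.
  - by move=> /double_inj kxy; apply: kI; rewrite ?inE.
  - by move=> /(congr1 odd); rewrite /= !odd_double.
  - by move=> /(congr1 odd); rewrite /= !odd_double.
  - by move=> [/double_inj ij]; rewrite xi yj ij.
(* [pickle] merges the code of the point and the extra integer into one index of the same
   sequence. *)
pose f (p : X * nat) := (c p.1).1 (pickle ((c p.1).2, p.2)).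
have fI : injective f.
  move=> [x m] [y n]; rewrite /f /= => exy.
  have [Fx _] := cP x; have [Fy _] := cP y; have /= cyI := Finj _ Fy.
  have c1 : (c x).1 = (c y).1.
    by apply: Fdis => //; exists (f (x, m)); split;
      [eexists|rewrite /f /= exy; eexists].
  move: exy; rewrite c1 => /cyI/(pcan_inj pickleK)[c2 ->].
  congr pair; by apply: cI; rewrite (surjective_pairing (c x)) c1 c2 -surjective_pairing.
have gI : injective (fun x : X => (x, 0)) by move=> x y [].
have := Cantor_Bernstein (injective_card_le fI) (injective_card_le gI).
by move=> /card_set_bijP[h]; exists h; rewrite -setTT_bijective.
Qed.

(** * Partitions as kernels of labellings *)

Lemma kernel_trans {T V : Type} (K : T -> V) (u v w : T) :
  K u = K v -> K v = K w -> K u = K w.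
Proof. by move=> ->. Qed.

Definition kernel {T V : Type} (K : T -> V) : set_partition T :=
  classes (fun u => erefl (K u)) (fun u v => @esym _ (K u) (K v))
    (kernel_trans K).

Lemma same_block_kernel {T V : Type} (K : T -> V) (u v : T) :
  same_block (kernel K) u v <-> K u = K v.
Proof. exact: same_block_classes. Qed.

(** This makes [same_block p u] a canonical label for the block of [u]. *)
Lemma same_block_eq {T : Type} (p : set_partition T) (u v : T) :
  same_block p u = same_block p v <-> same_block p u v.
Proof.
split=> [->|uv]; first exact: same_block_refl.
apply/funext => w; apply/propext; split; last exact: same_block_trans.
exact/same_block_trans/same_block_sym.
Qed.

Lemma kernel_same_block {T : Type} (p : set_partition T) :
  kernel (same_block p) = p.
Proof.
by apply: set_partitionP => u v; rewrite same_block_kernel same_block_eq.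
Qed.

(** * Multiplication by encoded maps *)

Definition map_upper {X : Type} (f : X -> X) (u : X + X) : X + X :=
  if u is inl x then inl (f x) else u.

Definition map_lower {X : Type} (f : X -> X) (u : X + X) : X + X :=
  if u is inr x then inr (f x) else u.

(** For injective [f], the blocks of [graph f] are the pairs [{x, (f x)'}] and the
    lower singletons outside the image of [f]. *)
Definition graph {X : Type} (f : X -> X) : partition_monoid X :=
  kernel (fun u => match u with inl x => f x | inr y => y end).

Definition cograph {X : Type} (f : X -> X) : partition_monoid X :=
  kernel (fun u => match u with inl x => x | inr y => f y end).

(** Labels constant along edges are constant along paths. A good [J] thus shows that a product joins
    no more than claimed; explicit paths give the converse. *)
Lemma product_graph_invariant {X V : Type} (a b : partition_monoid X)
    (J : vertex X -> V) :
  (forall u v, same_block a u v -> J (in_top u) = J (in_top v)) ->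
  (forall u v, same_block b u v -> J (in_bottom u) = J (in_bottom v)) ->
  forall u v, same_block (pmul a b) u v -> J (outer u) = J (outer v).
Proof.
move=> aJ bJ u v /same_block_pmul; rewrite /joined.
elim=> [_ _ [] [s [t [-> -> st]]]|//|x y z _ -> _ ->//].
- exact: aJ.
- exact: bJ.
Qed.

Lemma joined_through {X : Type} (a b : partition_monoid X) (u v : X + X)
    (p q : vertex X) :
  clos_refl_trans _ (product_graph a b) (outer u) p ->
  clos_refl_trans _ (product_graph a b) (outer v) q ->
  product_graph a b p q -> same_block (pmul a b) u v.
Proof.
move=> up vq pq; apply/same_block_pmul; apply: rt_trans up _.
apply: rt_trans (rt_step _ _ _ _ pq) _.
by apply: clos_sym vq => x y; exact: product_graph_sym.
Qed.

Lemma graph_pmul {X : Type} (f : X -> X) (a : partition_monoid X) (u v : X + X) :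
  same_block (pmul (graph f) a) u v <->
  same_block a (map_upper f u) (map_upper f v).
Proof.
pose J (p : vertex X) := same_block a
  match p with Upper x => inl (f x) | Middle x => inl x | Lower x => inr x end.
have outerJ w : J (outer w) = same_block a (map_upper f w) by case: w.
split=> [uv|uv].
  apply/same_block_eq; rewrite -!outerJ.
  apply: product_graph_invariant uv => s t.
    by move=> /same_block_kernel; case: s t => [s|s] [t|t] /= E; rewrite /J /= E.
  by move=> /same_block_eq; case: s t => [s|s] [t|t].
have outer_path w :
    clos_refl_trans _ (product_graph (graph f) a) (outer w) (in_bottom (map_upper f w)).
  case: w => x /=; last exact: rt_refl.
  apply: rt_step; left; exists (inl x), (inr (f x)).
  by split=> //; apply/same_block_kernel.
apply: joined_through (outer_path u) (outer_path v) _.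
by right; exists (map_upper f u), (map_upper f v).
Qed.

Lemma pmul_cograph {X : Type} (f : X -> X) (a : partition_monoid X) (u v : X + X) :
  same_block (pmul a (cograph f)) u v <->
  same_block a (map_lower f u) (map_lower f v).
Proof.
pose J (p : vertex X) := same_block a
  match p with Upper x => inl x | Middle x => inr x | Lower x => inr (f x) end.
have outerJ w : J (outer w) = same_block a (map_lower f w) by case: w.
split=> [uv|uv].
  apply/same_block_eq; rewrite -!outerJ.
  apply: product_graph_invariant uv => s t; last first.
    by move=> /same_block_kernel; case: s t => [s|s] [t|t] /= E; rewrite /J /= E.
  by move=> /same_block_eq; case: s t => [s|s] [t|t].
have outer_path w :
    clos_refl_trans _ (product_graph a (cograph f)) (outer w) (in_top (map_lower f w)).
  case: w => x /=; first exact: rt_refl.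
  apply: rt_step; right; exists (inr x), (inl (f x)).
  by split=> //; apply/same_block_kernel.
apply: joined_through (outer_path u) (outer_path v) _.
by left; exists (map_lower f u), (map_lower f v).
Qed.

Lemma graph_pmul_kernel {X V : Type} (f : X -> X) (K : X + X -> V) :
  pmul (graph f) (kernel K) = kernel (K \o map_upper f).
Proof.
by apply: set_partitionP => u v; rewrite graph_pmul !same_block_kernel.
Qed.

Lemma kernel_pmul_cograph {X V : Type} (f : X -> X) (K : X + X -> V) :
  pmul (kernel K) (cograph f) = kernel (K \o map_lower f).
Proof.
by apply: set_partitionP => u v; rewrite pmul_cograph !same_block_kernel.
Qed.

(** Powers are iterated multiplications, so exponent 0 calls for no identity element, which a
    subsemigroup may lack. *)
Lemma iter_graph_pmul_kernel {X V : Type} (f : X -> X) (K : X + X -> V) n :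
  iter n (pmul (graph f)) (kernel K) = kernel (K \o map_upper (iter n f)).
Proof.
elim: n => [|n IHn] /=; first by congr kernel; apply/funext => -[].
rewrite IHn graph_pmul_kernel; congr kernel; apply/funext => -[x|//] /=.
by rewrite -iterSr.
Qed.

Lemma iter_kernel_pmul_cograph {X V : Type} (f : X -> X) (K : X + X -> V) n :
  iter n (fun w => pmul w (cograph f)) (kernel K) =
  kernel (K \o map_lower (iter n f)).
Proof.
elim: n => [|n IHn] /=; first by congr kernel; apply/funext => -[].
rewrite IHn kernel_pmul_cograph; congr kernel; apply/funext => -[//|x] /=.
by rewrite -iterSr.
Qed.

(** [pmul (graph f) (kernel L)] may differ from [graph g] by relations between
    lower vertices in the image of [f]; these are harmless as soon as [kernel K]
    does not connect the upper vertices of that image to anything else. *)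
Lemma graph_pmul_junk {X V W : Type} (f g : X -> X)
    (L : X + X -> V) (K : X + X -> W) :
  (forall x z, g x <> f z) ->
  (forall t, (exists x, t = g x) \/ (exists z, t = f z)) ->
  (forall x, L (inl (f x)) = L (inr (g x))) ->
  (forall x v, L (inl (f x)) = L v -> v = inl (f x) \/ v = inr (g x)) ->
  (forall z u, K (inl (f z)) = K u -> exists z', u = inl (f z')) ->
  pmul (graph f) (pmul (kernel L) (kernel K)) = kernel (K \o map_upper g).
Proof.
move=> gf cover Lfg Lf Kf; apply: set_partitionP => u v.
rewrite graph_pmul same_block_kernel /=; split=> [|Kuv]; last first.
  have outer_path w : clos_refl_trans _ (product_graph (kernel L) (kernel K))
      (outer (map_upper f w)) (in_bottom (map_upper g w)).
    case: w => x /=; last exact: rt_refl.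
    apply: rt_step; left; exists (inl (f x)), (inr (g x)).
    by split=> //; apply/same_block_kernel.
  apply: joined_through (outer_path u) (outer_path v) _.
  by right; exists (map_upper g u), (map_upper g v); split=> //;
    apply/same_block_kernel.
(* Invariant of the vertices reachable from the start: an upper vertex [f x] is tested through its
   middle partner [g x]. *)
pose Q (p : vertex X) := match p with
  | Upper t => exists2 x, t = f x & K (map_upper g u) = K (inl (g x))
  | Middle t => K (map_upper g u) = K (inl t)
  | Lower t => K (map_upper g u) = K (inr t) end.
have QL x t : K (map_upper g u) = K (inl (g x)) -> L (inl (f x)) = L t ->
    Q (in_top t).
  by move=> Kx /Lf[->|->] //=; exists x.
move=> /same_block_pmul uv.
have : Q (outer (map_upper f v)).
  apply: clos_preserve uv _ => [_ _ [] [s [t [-> -> /same_block_kernel]]]|].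
  - case: s => s /=; first by move=> Lst [x sx Kx]; apply: (QL x); rewrite -?sx.
    move=> Lst Ks; have [[x sx]|[z sz]] := cover s.
      by apply: (QL x); rewrite -?sx// Lfg -sx.
    (* Here [s] is a junk vertex: [K] ties it only to the upper image of [f], which [map_upper g u]
       avoids, so no path reaches it. *)
    have [z' uz'] : exists z', map_upper g u = inl (f z').
      by apply: (Kf z); rewrite -sz -Ks.
    by move: uz'; case: (u) => //= ? [/gf].
  - by case: s t => [s|s] [t|t] /= <-.
  - by case Eu: u => [x|y] /=; [exists x|]; rewrite ?Eu.
case: (v) => //= x [x' fxx' ->].
have Lx : L (inl (f x)) = L (inr (g x')) by rewrite fxx' Lfg.
by case: (Lf _ _ Lx) => // -[->].
Qed.

(** * Four generators for a sequence *)

Lemma sequence_generated {X : Type} (a : nat -> partition_monoid X) :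
  infinite_set [set: X] ->
  exists2 G : set (partition_monoid X),
    (G #<= `I_4)%card & forall n, generated_by G (a n).
Proof.
move=> /infinite_bij_prod_nat[phi [psi phiK psiK]].
pose sigma x := phi ((psi x).1, (psi x).2.+1).
pose beta x := phi (x, 0).
(* In the [inr] labels, the index keeps the copies of different terms of [a] apart. *)
pose L u := match u with
  | inl z => match psi z with
             | (x, i.+1) => inl (phi (x, i))
             | (x, 0) => inr ((psi x).2, same_block (a (psi x).2) (inl (psi x).1))
             end
  | inr z => match psi z with
             | (x, i.+1) => inr (i, same_block (a i) (inr x))
             | (x, 0) => inl x
             end
  end.
have iter_sigma n x : iter n sigma x = phi ((psi x).1, n + (psi x).2).
  by elim: n => [|n IHn] /=; rewrite -?surjective_pairing ?psiK// IHn /sigma phiK.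
have Lsigma x : L (inl (sigma x)) = inl x.
  by rewrite /L /sigma phiK -surjective_pairing psiK.
have junk V (K : X + X -> V) :
    (forall z u, K (inl (sigma z)) = K u -> exists z', u = inl (sigma z')) ->
    pmul (graph sigma) (pmul (kernel L) (kernel K)) =
    kernel (K \o map_upper beta).
  apply: graph_pmul_junk.
  - by move=> x z /(congr1 psi); rewrite !phiK.
  - move=> t; rewrite -(psiK t); case: (psi t) => x [|i]; first by left; exists x.
    by right; exists (phi (x, i)); rewrite /sigma phiK.
  - by move=> x; rewrite Lsigma /L /beta phiK.
  - move=> x v; rewrite Lsigma; case: v => z /=; case E: (psi z) => [y [|i]] //.
      by move=> [->]; left; congr inl; rewrite -(psiK z) E /sigma phiK.
    by move=> [->]; right; congr inr; rewrite -(psiK z) E.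
exists [set graph sigma; cograph sigma; cograph beta; kernel L] => [|n].
  (* The default value of [nth] supplies the fourth generator, at index 3. *)
  pose g i := nth (kernel L) [:: graph sigma; cograph sigma; cograph beta] i.
  apply: card_le_trans (card_image_le g `I_4); apply: subset_card_le.
  by move=> x [[[->|->]|->]|->]; [exists 0|exists 1|exists 2|exists 3].
(* The lower vertex [y] is moved to coordinates [(y, n.+1)], where [L] carries the lower half of
   [a n]. *)
pose K0 u := match u with inl _ => L u | inr y => inr (n, same_block (a n) u) end.
pose w0 := pmul (iter n.+1 (fun w => pmul w (cograph sigma)) (kernel L))
  (cograph beta).
have w0E : w0 = kernel K0.
  rewrite /w0 iter_kernel_pmul_cograph kernel_pmul_cograph.
  congr kernel; apply/funext => -[//|y].
  by rewrite /comp /map_lower iter_sigma /beta phiK /L phiK /= addn0.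
pose w1 := pmul (graph sigma) (pmul (kernel L) w0).
have w1E : w1 = kernel (K0 \o map_upper beta).
  rewrite /w1 w0E; apply: junk => z u; rewrite /K0 Lsigma.
  case: u => [x|//]; rewrite /L; case E: (psi x) => [y [|i]] // _.
  by exists (phi (y, i)); rewrite /sigma phiK -E psiK.
pose w2 := iter n (pmul (graph sigma)) w1.
have w2E : w2 = kernel (K0 \o map_upper beta \o map_upper (iter n sigma)).
  by rewrite /w2 w1E iter_graph_pmul_kernel.
have K2E x : (K0 \o map_upper beta \o map_upper (iter n sigma)) (inl x) =
    inr (n + (psi x).2, same_block (a (n + (psi x).2)) (inl (psi x).1)).
  by rewrite /comp /map_upper iter_sigma /K0 /L /beta !phiK.
have anE : a n = pmul (graph sigma) (pmul (kernel L) w2).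
  rewrite w2E junk.
    rewrite -[LHS]kernel_same_block; apply: set_partitionP => u v.
    have KE t : (K0 \o map_upper beta \o map_upper (iter n sigma) \o
        map_upper beta) t = inr (n, same_block (a n) t).
      case: t => [x|//]; rewrite [LHS]/comp K2E /beta phiK addn0//.
    rewrite !same_block_kernel !KE; split=> [->//|[]//].
  (* At an upper vertex [sigma z] the index exceeds [n], the index of all lower vertices; upper
     vertices sharing it are again in the image of [sigma]. *)
  move=> z [x|y]; rewrite K2E; last first.
    by move=> [/eqP]; rewrite /sigma phiK -[X in _ == X]addn0 eqn_add2l.
  rewrite K2E => -[/addnI]; rewrite /sigma phiK /= => zx _.
  exists (phi ((psi x).1, (psi z).2)).
  by rewrite phiK /= zx -surjective_pairing psiK.
rewrite anE => M [Msub GM].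
have [Ms [Mcs [Mcb ML]]] : M (graph sigma) /\ M (cograph sigma) /\
    M (cograph beta) /\ M (kernel L).
  by do !split; apply: GM; [left; left; left|left; left; right|left; right|right].
have iterM k f w : (forall w, M w -> M (f w)) -> M w -> M (iter k f w).
  by move=> fM Mw; elim: k => //= k; exact: fM.
apply: (Msub _ _ Ms); apply: (Msub _ _ ML).
apply: (iterM n) => [w|]; first exact: (Msub _ _ Ms).
apply: (Msub _ _ Ms); apply: (Msub _ _ ML).
apply: (Msub _ _ _ Mcb); apply: (iterM n.+1) => // w Mw.
exact: (Msub _ _ Mw Mcs).
Qed.

Theorem theorem37 (X : Type) (X_infinite : infinite_set [set: X]) :
  rank_le (sierpinski_rank (partition_monoid X)) 4 /\
  (forall A : set (partition_monoid X), countable A ->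
     exists2 G : set (partition_monoid X),
       (G #<= `I_4)%card & A `<=` generated_by G).
Proof.
have gen : countable_sets_generated (partition_monoid X) 4.
  move=> A /countable_injP[f fI].
  have /choice[a aP] (n : nat) : exists p, forall q, A q -> f q = n -> p = q.
    have [[p [Ap <-]]|nA] := pselect (exists p, A p /\ f p = n).
      by exists p => q Aq fqp; apply: fI; rewrite ?inE.
    (* Integers that encode no element of [A] get the dummy value [pone X]. *)
    by exists (pone X) => q Aq fq; case: nA; exists q.
  have [G G4 Ga] := sequence_generated a X_infinite.
  by exists G => // p Ap; rewrite -(aP (f p) p).
split=> //; rewrite /sierpinski_rank.
case: pselect => [ex|[]]; last by exists 4; apply/asboolP.
by case: ex_minnP => m _; apply; apply/asboolP.
Qed.
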